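(* For every integer $n\geq 1$, the number of Dyck paths $D$ of semilength $n$ with $L(D)=1$ is $$|\mathcal{D}_n^1| = M_{n-1},$$ where $M_{n-1}$ is the $(n-1)$st Motzkin number.
   Context: A Dyck path of semilength $n$ is a path from $(0,0)$ to $(2n,0)$ with up steps $u=(1,1)$ and down steps $d=(1,-1)$ that does not pass below the $x$-axis; $\mathcal{D}_n$ is the set of these. For $D\in\mathcal{D}_n$ and $1\le i\le n-1$, $r_i(D)$ is the number of down steps between the $i$th and $(i+1)$st up steps of $D$, and $s_i(D)$ is the number of up steps between the $i$th and $(i+1)$st down steps of $D$. The statistic $L$ is $L(D)=\prod_{i=1}^{n-1}\binom{r_i(D)+s_i(D)}{r_i(D)}$ (empty product $=1$). $\mathcal{D}_n^k=\{D\in\mathcal{D}_n : L(D)=k\}$. A Motzkin path of length $n$ is a path from $(0,0)$ to $(n,0)$ with steps $u=(1,1)$, $d=(1,-1)$, $h=(1,0)$ that does not pass below the $x$-axis; $M_n$ is the number of Motzkin paths of length $n$ (the $n$th Motzkin number). *)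

(* Defs.v *)
From mathcomp Require Import all_boot all_order all_algebra.

Set Implicit Arguments.
Unset Strict Implicit.
Unset Printing Implicit Defensive.

(* A lattice path starting on the x-axis, given by the sequence of the vertical
   displacements of its steps: it ends on the x-axis and never passes below. *)
Definition excursion (s : seq int) : bool :=
  ((\sum_(x <- s) x == 0) &&
   [forall k : 'I_(size s).+1, 0 <= \sum_(x <- take k s) x])%R.

(* Steps of Dyck paths are booleans; steps of Motzkin paths are optional
   booleans, None being the horizontal step. *)
Notation up := true (only parsing).
Notation down := false (only parsing).

Definition dyck_rise (x : bool) : int := if x then 1%R else (-1)%R.

Definition motzkin_rise (x : option bool) : int := oapp dyck_rise 0%R x.

Definition Dyck (n : nat) : {set (2 * n).-tuple bool} :=
  [set D : (2 * n).-tuple bool | excursion (map dyck_rise D)].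

Definition Motzkin (n : nat) : {set n.-tuple (option bool)} :=
  [set P : n.-tuple (option bool) | excursion (map motzkin_rise P)].

Definition motzkin_number (n : nat) : nat := #|Motzkin n|.

(* Position (counted from 0) in D of the i-th step equal to a, where i is
   counted from 1; it is size D if there are fewer than i such steps. *)
Definition step_pos (a : bool) (D : seq bool) (i : nat) : nat :=
  nth (size D) [seq j <- iota 0 (size D) | nth a D j == a] i.-1.

Definition steps_between (a : bool) (D : seq bool) (i : nat) : seq bool :=
  drop (step_pos a D i).+1 (take (step_pos a D i.+1) D).

Definition dyck_r (D : seq bool) (i : nat) : nat :=
  count_mem down (steps_between up D i).

Definition dyck_s (D : seq bool) (i : nat) : nat :=
  count_mem up (steps_between down D i).

Definition dyck_L (n : nat) (D : (2 * n).-tuple bool) : nat :=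
  \prod_(1 <= i < n) 'C(dyck_r D i + dyck_s D i, dyck_r D i).

Definition DyckL (n k : nat) : {set (2 * n).-tuple bool} :=
  [set D in Dyck n | dyck_L D == k].

(* Main.v *)
Require Import Defs.
From mathcomp Require Import all_boot all_order all_algebra.
From mathcomp Require Import zify.

Set Implicit Arguments.
Unset Strict Implicit.
Unset Printing Implicit Defensive.

(** A binomial coefficient C(r + s, r) is 1 exactly when r = 0 or s = 0, so
    L(D) = 1 says that for no i in 1..n-1 are both the i-th up step followed
    at once by a down step and the i-th down step followed at once by an up
    step.  Read position i as d in the first case, as u in the second, and as
    h in neither; this turns D into a word P of length n - 1 over the Motzkin
    steps, and the theorem is that D |-> P is a bijection onto Motzkin paths.

    It is convenient to record D by two bit lists, [turns up D] and
    [turns down D], telling for each step of the given kind whether the path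
    changes direction right after it.  The end of D counts as a change, so
    that both lists end in true and their first n - 1 bits carry the
    information; [encodes P D] says that these bits are those of P.

    - D can be read off from its two lists: the first step is known, and each
      bit says whether to go on with the same list or to switch to the other
      ([turns_inj]).  Conversely the same procedure, run on two lists whose
      numbers of changes are equal, uses up both of them and yields a word
      with these lists ([turns_weave]).

    - D stays above the axis iff P does ([encodes_excursion]).  Changes of
      direction alternate, so at a point of D reached after i up and j down
      steps, the numbers X(i) and Y(j) of changes after the first i up and the
      first j down steps are equal if the next step is up, and X(i) = Y(j) + 1
      if it is down ([count_turns_prefix]).  The height of P after t steps is
      Y(t) - X(t).  If D is a Dyck path, then just before its (t+1)-st up step
      j <= t, so X(t) = Y(j) <= Y(t).  If P is a Motzkin path, then before each
      down step of D, Y(j) < X(i) <= Y(i), so j < i and the step does not lead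
      below the axis. *)

(** * Excursions and counting *)

Lemma excursion_count (T : Type) (f : T -> int) (a b : pred T) (s : seq T) :
    (forall x, f x = (a x)%:Z - (b x)%:Z)%R ->
  excursion (map f s) <->
  count a s = count b s /\ forall k, count b (take k s) <= count a (take k s).
Proof.
move=> fE; have sumE t : (\sum_(x <- map f t) x = (count a t)%:Z - (count b t)%:Z)%R.
  by elim: t => [|x t IHt]; rewrite /= ?big_nil // big_cons IHt fE; lia.
rewrite /excursion sumE; split=> [/andP[/eqP tot /forallP pos] | [tot pos]].
  split=> [|k]; first by lia.
  have [ltk | /ltnW lek] := ltnP k (size s).+1; last by rewrite take_oversize //; lia.
  have ltk' : k < (size (map f s)).+1 by rewrite size_map.
  by have := pos (Ordinal ltk'); rewrite /= -map_take sumE; lia.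
apply/andP; split; first by rewrite tot; apply/eqP; lia.
by apply/forallP=> k; rewrite -map_take sumE; have := pos k; lia.
Qed.

(** * Changes of direction *)

(** The default value of [head] makes the end of the word count as a change of
    direction for its last step. *)
Fixpoint turns (a : bool) (D : seq bool) : seq bool :=
  if D is b :: D' then
    if b == a then (head (~~ a) D' != a) :: turns a D' else turns a D'
  else [::].

Lemma size_turns a D : size (turns a D) = count_mem a D.
Proof. by elim: D => //= b D IH; case: eqP => _ /=; rewrite IH. Qed.

Lemma last_turns a D : last true (turns a D).
Proof.
elim: D => //= b D IH; case: eqP => _ //=.
by case: D IH => [|c D] /=; [case: a | case: eqP].
Qed.

(** The assumption on the heads passes to the tails because the first bit of
    the list of the common first step determines the next step. *)
Lemma turns_inj D D' :
    turns up D = turns up D' -> turns down D = turns down D' ->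
  head up D = head up D' -> D = D'.
Proof.
elim: D D' => [|b D IH] [|b' D'] //=; first by case: b'.
  by case: b.
move=> Eu Ed Eb; move: Eb Eu Ed => <- Eu Ed; congr (_ :: _).
case: b Eu Ed => /= [[Eh Eu] Ed | Eu [Eh Ed]]; apply: IH => //.
  (* If just one of the words has ended, the first bits may still agree, but
     then the lists of the other letter differ in length. *)
  case: D D' Eh Eu Ed => [|[] D] [|[] D'] //=.
by case: D D' Eh Eu Ed => [|[] D] [|[] D'] //=.
Qed.

(** Up-to-down and down-to-up changes alternate.  Hence on any prefix the two
    numbers of changes differ only by a correction for the direction in which
    the word starts and for the one in which it goes on after the prefix. *)
Lemma count_turns_prefix D k : k < size D ->
  count id (take (count_mem up (take k D)) (turns up D)) + (head up D == down) =
  count id (take (count_mem down (take k D)) (turns down D)) + (nth up D k == down).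
Proof.
elim: D k => // b D IH [|k] /=; first by rewrite !take0.
rewrite ltnS => ltk; have := IH k ltk.
by case: b; case: D ltk {IH} => //= -[] D _; rewrite !(add0n, add1n) /=; lia.
Qed.

Lemma nth_step_exists a D t : t < count_mem a D ->
  exists k, [/\ k < size D, nth up D k = a & count_mem a (take k D) = t].
Proof.
elim: D t => //= b D IH t; case: (eqVneq b a) => [-> | ba] /=.
  case: t => [|t]; first by exists 0.
  by case/IH=> k [? ? kt]; exists k.+1; split; rewrite //= eqxx kt.
case/IH=> k [? ? kt]; exists k.+1; split=> //=.
by rewrite kt (negPf ba).
Qed.

(** * Dyck words encoded by Motzkin words *)

Definition marks (a : bool) (P : seq (option bool)) : seq bool :=
  rcons [seq x == Some a | x <- P] true.

(** The letters are crossed: a change after the i-th up step is a down step of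
    P, since the changes after up steps must come later than the corresponding
    changes after down steps. *)
Definition encodes (P : seq (option bool)) (D : seq bool) : Prop :=
  [/\ head up D = up, turns up D = marks down P & turns down D = marks up P].

Lemma size_marks a P : size (marks a P) = (size P).+1.
Proof. by rewrite size_rcons size_map. Qed.

Lemma encodes_count a P D : encodes P D -> count_mem a D = (size P).+1.
Proof. by case=> _ Eu Ed; rewrite -size_turns; case: a; rewrite ?Eu ?Ed size_marks. Qed.

Lemma encodes_size P D : encodes P D -> size D = 2 * (size P).+1.
Proof.
move=> PD; rewrite -(count_predC (pred1 up)) (encodes_count up PD).
rewrite (@eq_count _ _ (pred1 down)) ?(encodes_count down PD); [lia | by case].
Qed.

Lemma count_take_marks a P t : t <= size P ->
  count id (take t (marks a P)) = count_mem (Some a) (take t P).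
Proof.
move=> let_; rewrite /marks -cats1 takel_cat ?size_map // -map_take count_map.
exact: eq_count.
Qed.

Lemma count_marks a P : count id (marks a P) = (count_mem (Some a) P).+1.
Proof.
by rewrite /marks -cats1 count_cat count_map /= addn1; congr _.+1; apply: eq_count.
Qed.

Lemma count_take_mono (T : Type) (a : pred T) (s : seq T) i j :
  i <= j -> count a (take i s) <= count a (take j s).
Proof.
by move=> leij; rewrite -(subnKC leij) takeD count_cat leq_addr.
Qed.

Lemma excursion_dyck D :
  excursion (map dyck_rise D) <->
  count_mem up D = count_mem down D /\
  forall k, count_mem down (take k D) <= count_mem up (take k D).
Proof. by apply: excursion_count; case. Qed.

Lemma excursion_motzkin P :
  excursion (map motzkin_rise P) <->
  count_mem (Some up) P = count_mem (Some down) P /\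
  forall k, count_mem (Some down) (take k P) <= count_mem (Some up) (take k P).
Proof. by apply: excursion_count; do 2?case. Qed.

Lemma encodes_balance P D k : encodes P D -> k < size D ->
  count id (take (count_mem up (take k D)) (marks down P)) =
  count id (take (count_mem down (take k D)) (marks up P)) + (nth up D k == down).
Proof.
by case=> hD Eu Ed /count_turns_prefix; rewrite Eu Ed hD addn0.
Qed.

(** The comparison is made at the steps of D: the points just before an up step
    give the positivity of P, those just before a down step that of D.  The
    last down step gives the part of the equality of the numbers of up and
    down steps of P that positivity leaves open. *)
Lemma encodes_excursion P D : encodes P D ->
  excursion (map dyck_rise D) <-> excursion (map motzkin_rise P).
Proof.
move=> PD; rewrite excursion_dyck excursion_motzkin.
have cnt a := encodes_count a PD.
split=> [[_ posD] | [totP posP]].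
  have posP t : t <= size P ->
      count_mem (Some down) (take t P) <= count_mem (Some up) (take t P).
    move=> leP; have [|k [ltk Dk kt]] := @nth_step_exists up D t.
      by rewrite cnt.
    have := encodes_balance PD ltk; rewrite Dk kt addn0.
    rewrite count_take_marks // => ->; rewrite -count_take_marks //.
    by apply: count_take_mono; rewrite -kt.
  split=> [|k]; last first.
    have [lek | /ltnW gek] := leqP k (size P); first exact: posP.
    by have := posP _ (leqnn _); rewrite !take_oversize.
  apply/eqP; rewrite eqn_leq andbC.
  have := posP _ (leqnn (size P)); rewrite take_size => -> /=.
  have [|k [ltk Dk kt]] := @nth_step_exists down D (size P).
    by rewrite cnt.
  have := encodes_balance PD ltk.
  rewrite Dk kt (count_take_marks _ (leqnn (size P))) take_size /=.
  rewrite addn1 => bal; rewrite -ltnS -bal -count_marks.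
  rewrite -[X in _ <= count id X](cat_take_drop (count_mem up (take k D))).
  by rewrite count_cat leq_addr.
have posM t : count id (take t (marks down P)) <= count id (take t (marks up P)).
  have [lek | gtk] := leqP t (size P); first by rewrite !count_take_marks.
  by rewrite !take_oversize ?size_marks // !count_marks totP.
split=> [|k]; first by rewrite !cnt.
elim: k => [|k IHk]; first by rewrite take0.
have [lek | ltk] := leqP (size D) k.
  by move: IHk; rewrite !take_oversize // (leq_trans lek).
rewrite (take_nth up ltk) -!cats1 !count_cat /=.
rewrite !addn0; case Dk: (nth up D k); first by rewrite addn0 (leq_trans IHk) ?leq_addr.
have := encodes_balance PD ltk; rewrite Dk /= addn0 !addn1 => bal.
rewrite ltnNge; apply/negP => leud.
have := posM (count_mem up (take k D)); rewrite bal ltnNge.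
by rewrite count_take_mono.
Qed.

(** * Recovering a word from its changes of direction *)

(** In [weave k a p q] the word continues with the letter [a]; [p] holds the
    bits of the remaining letters [a], [q] those of the other letter, and [k]
    is fuel. *)
Fixpoint weave (k : nat) (a : bool) (p q : seq bool) : seq bool :=
  if (k, p) is (k'.+1, t :: p') then
    a :: if t then weave k' (~~ a) q p' else weave k' a p' q
  else [::].

Lemma head_weave k a p q : head a (weave k a p q) = a.
Proof. by case: k p => [|k] []. Qed.

Lemma last_true_count0 q : last true q -> count id q = 0 -> q = [::].
Proof.
case/lastP: q => // q t; rewrite last_rcons => ->.
by rewrite -cats1 count_cat addn1.
Qed.

(** The bounds on the numbers of changes are what keeps one list from running
    out while the other one is still in use: when [p] is empty, [q] has no
    change left, and as its last bit is true it is empty too.  The bounds are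
    invariant when the roles of the lists are exchanged. *)
Lemma turns_weave k a p q : size p + size q <= k ->
    last true p -> last true q -> count id q <= count id p <= (count id q).+1 ->
  turns a (weave k a p q) = p /\ turns (~~ a) (weave k a p q) = q.
Proof.
elim: k a p q => [|k IH] a [|t p] q.
- by case: q.
- by [].
- move=> _ _ lq; rewrite leqn0 => /andP[/eqP cq _].
  by rewrite (last_true_count0 lq cq).
have neg_a : (a == ~~ a) = false by case: a.
case: t => /= sz lp lq cnt; rewrite eqxx neg_a.
  have [||||-> ] := IH (~~ a) q p; [lia | by [] | by case: (p) lp | lia |].
  rewrite negbK => ->; split=> //.
  by rewrite head_weave eq_sym neg_a.
case: p lp sz cnt => // t p lp sz cnt.
have [||||Ep ->] := IH a (t :: p) q; [move: sz => /=; lia | by [] | by [] | by [] |].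
by case: weave (head_weave k a (t :: p) q) Ep => //= b D -> <-; rewrite eqxx.
Qed.

(** * The statistic L in terms of changes of direction *)

Lemma step_pos_cons a b D i :
  step_pos a (b :: D) i.+1 =
  if b == a then if i is _.+1 then (step_pos a D i).+1 else 0
  else (step_pos a D i.+1).+1.
Proof.
have nthS s d j : nth d.+1 (map S s) j = (nth d s j).+1.
  by elim: s j => [|x s IHs] [|j] //=.
rewrite /step_pos /= -[1]/(1 + 0)%N iotaDl filter_map.
by case: eqP => _; case: i => [|i] //=; rewrite nthS.
Qed.

(** The last step [a] is excluded: if it ends the word, its bit is true although
    no step of the other kind comes after it. *)
Lemma nth_turns a D i : i.+1 < count_mem a D ->
  nth true (turns a D) i = (0 < count_mem (~~ a) (steps_between a D i.+1)).
Proof.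
elim: D i => // b D IH i; rewrite /steps_between !step_pos_cons /=.
case: eqP => [-> | _] /=; last by apply: IH.
case: i => [|i]; rewrite ltnS; last by apply: IH.
rewrite drop0; case: D {IH} => // c D _; rewrite step_pos_cons.
by case: (eqVneq c a) => //=; case: a; case: c.
Qed.

Lemma bin_add_eq1 r s : ('C(r + s, r) == 1) = ~~ ((0 < r) && (0 < s)).
Proof.
case: r s => [|r] [|s]; rewrite ?bin0 ?addn0 ?binn //=.
have := bin_gt0 (r + s.+1) r.+1; have := bin_gt0 (r + s.+1) r.
by rewrite addSn binS; lia.
Qed.

Lemma dyck_L_eq1 m (D : (2 * m.+1).-tuple bool) :
    count_mem up D = m.+1 -> count_mem down D = m.+1 ->
  dyck_L D == 1 <->
  forall i, i < m -> ~~ (nth true (turns up D) i && nth true (turns down D) i).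
Proof.
move=> cu cd; rewrite /dyck_L prod_nat_seq_eq1; split=> [/allP L1 i ltim | disj].
  rewrite !nth_turns ?cu ?cd // -bin_add_eq1; apply: L1.
  by rewrite mem_index_iota.
apply/allP=> -[|i]; rewrite mem_index_iota // => /andP[_ ltim].
by rewrite bin_add_eq1 -!nth_turns ?cu ?cd //; apply: disj.
Qed.

(** * The bijection *)

(** A position at which both lists have a change is sent to a down step; it
    does not occur when L(D) = 1. *)
Definition motzkin_step (x y : bool) : option bool :=
  if x then Some down else if y then Some up else None.

Definition turn_path (m : nat) (D : seq bool) : m.-tuple (option bool) :=
  [tuple motzkin_step (nth true (turns up D) i) (nth true (turns down D) i) | i < m].

Lemma nth_turn_path m D i : i < m ->
  nth None (turn_path m D) i =
  motzkin_step (nth true (turns up D) i) (nth true (turns down D) i).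
Proof. by move=> lt; rewrite (nth_mktuple _ _ (Ordinal lt)). Qed.

Lemma nth_marks a P i : i < size P -> nth true (marks a P) i = (nth None P i == Some a).
Proof. by move=> lt; rewrite nth_rcons size_map lt (nth_map None). Qed.

Lemma encodes_turn_path m D :
    head up D = up -> count_mem up D = m.+1 -> count_mem down D = m.+1 ->
    (forall i, i < m -> ~~ (nth true (turns up D) i && nth true (turns down D) i)) ->
  encodes (turn_path m D) D.
Proof.
move=> hD cu cd disj.
have turnsE a : count_mem a D = m.+1 ->
    (forall i, i < m -> nth true (turns a D) i =
                        (nth None (turn_path m D) i == Some (~~ a))) ->
    turns a D = marks (~~ a) (turn_path m D).
  move=> ca eqa; apply: (@eq_from_nth _ true) => [|i].
    by rewrite size_turns ca size_marks size_tuple.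
  rewrite size_turns ca ltnS leq_eqVlt => /predU1P[-> | lt]; last first.
    by rewrite nth_marks ?size_tuple // eqa.
  (* The last bit, which is true in both lists. *)
  rewrite nth_rcons size_map size_tuple ltnn eqxx.
  by have := last_turns a D; rewrite -nth_last size_turns ca.
by split=> //; apply: turnsE => // i lt; rewrite nth_turn_path //;
  have := disj i lt; do 2!case: nth.
Qed.

Lemma encodes_disjoint P D i : encodes P D -> i < size P ->
  ~~ (nth true (turns up D) i && nth true (turns down D) i).
Proof. by case=> _ -> -> lt; rewrite !nth_marks //; case: nth => // -[]. Qed.

Lemma encodes_inj_dyck P D D' : encodes P D -> encodes P D' -> D = D'.
Proof. by case=> hD Eu Ed [hD' Eu' Ed']; apply: turns_inj; congruence. Qed.

Lemma encodes_inj_motzkin P P' D : encodes P D -> encodes P' D -> P = P'.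
Proof.
case=> _ Eu Ed [_ Eu' Ed']; have szP : size P = size P'.
  by apply: succn_inj; rewrite -!(size_marks up) -Ed -Ed'.
apply: (@eq_from_nth _ None) => // i lt.
have := nth_marks up lt; have := nth_marks down lt.
rewrite -Eu -Ed Eu' Ed' !nth_marks -?szP //.
by case: (nth None P i) => [[]|]; case: (nth None P' i) => [[]|].
Qed.

Lemma encodes_exists P : excursion (map motzkin_rise P) ->
  exists D, encodes P D.
Proof.
case/excursion_motzkin=> tot _.
exists (weave (2 * (size P).+1) up (marks down P) (marks up P)).
have [||||Eu Ed] := @turns_weave (2 * (size P).+1) up (marks down P) (marks up P).
- by rewrite !size_marks; lia.
- by rewrite last_rcons.
- by rewrite last_rcons.
- by rewrite !count_marks tot; lia.
by split=> //; apply: head_weave.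
Qed.

Lemma DyckL1_encodes m (D : (2 * m.+1).-tuple bool) :
  D \in DyckL m.+1 1 -> encodes (turn_path m D) D.
Proof.
rewrite !inE => /andP[/excursion_dyck[tot pos] L1].
have := count_predC (pred1 up) D.
rewrite (@eq_count _ (predC _) (pred1 down)) ?size_tuple; last by case.
move=> sz; have cu : count_mem up D = m.+1 by lia.
have cd : count_mem down D = m.+1 by lia.
apply: encodes_turn_path => //; last exact/(dyck_L_eq1 cu cd).
by have := pos 1; case: (val D) => [|[] ? /=] //; rewrite take0.
Qed.

Lemma encodes_DyckL1 m P (D : (2 * m.+1).-tuple bool) : size P = m ->
  encodes P D -> excursion (map motzkin_rise P) -> D \in DyckL m.+1 1.
Proof.
move=> szP PD exP; rewrite !inE; apply/andP; split.
  exact/(encodes_excursion PD).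
apply/dyck_L_eq1; rewrite ?(encodes_count _ PD) ?szP // => i lt.
by apply: (encodes_disjoint PD); rewrite szP.
Qed.

Theorem theorem3p1 (n : nat) (hn : 1 <= n) :
  #|DyckL n 1| = motzkin_number n.-1.
Proof.
case: n hn => // m _; rewrite /motzkin_number /=.
have f_inj :
    {in DyckL m.+1 1 &, injective (fun D : (2 * m.+1).-tuple bool => turn_path m D)}.
  move=> D D' /DyckL1_encodes PD /DyckL1_encodes PD' eqP.
  by apply/val_inj/(encodes_inj_dyck PD); rewrite eqP.
rewrite -(card_in_imset f_inj); apply: eq_card => P.
apply/imsetP/idP => [[D D1 ->] | ]; rewrite inE.
  have PD := DyckL1_encodes D1; apply/(encodes_excursion PD).
  by move: D1; rewrite !inE => /andP[].
move=> exP; have [D PD] := encodes_exists exP.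
have szD : size D == 2 * m.+1 by rewrite (encodes_size PD) size_tuple.
have D1 := @encodes_DyckL1 m P (Tuple szD) (size_tuple P) PD exP.
exists (Tuple szD) => //; apply: val_inj.
exact: (encodes_inj_motzkin PD (DyckL1_encodes D1)).
Qed.
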